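(* Let $K$ be a field. For every integer $m \geq 5$, there exists a monomial ideal $I\subset K[x,y]$ such that $\mu(I)=m$ and $\mu(I^2) = 9$.
   Context: For an ideal $J$ of the polynomial ring $K[x,y]$, $\mu(J)$ denotes the least number of generators of $J$. A monomial ideal is an ideal generated by monomials $x^iy^j$ ($i,j\in\mathbb{N}$, with $0 \in \mathbb{N}$); for such an ideal $J$, $\mu(J)$ equals the cardinality of its unique minimal system of monomial generators $\mathcal{G}(J)$, which consists of all monomials in $J$ that are minimal under divisibility. *)

(* Defs.v *)
From mathcomp Require Import all_boot all_algebra.
From mathcomp Require Import classical_sets.
From mathcomp Require Import mpoly.

Set Implicit Arguments.
Unset Strict Implicit.
Unset Printing Implicit Defensive.

Import GRing.Theory.
Local Open Scope classical_set_scope.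
Local Open Scope ring_scope.

(* [idealr_closed] of MathComp's ring_quotient only covers proper ideals given
   by boolean predicates; here the unit ideal is an ideal. *)
Definition is_ideal (R : comNzRingType) (J : set R) : Prop :=
  [/\ J 0,
      forall f g, J f -> J g -> J (f + g)
    & forall r f, J f -> J (r * f)].

Definition ideal_gen (R : comNzRingType) (S : set R) : set R :=
  smallest (@is_ideal R) S.

Definition ideal_mul (R : comNzRingType) (I J : set R) : set R :=
  ideal_gen [set f * g | f in I & g in J].

(* [is_mu J n] reads "mu(J) = n".  A list of generators may contain
   repetitions; this does not affect the minimum. *)
Definition is_mu (R : comNzRingType) (J : set R) (n : nat) : Prop :=
  (exists s : seq R, size s = n /\ J = ideal_gen [set` s])
  /\ (forall s : seq R, J = ideal_gen [set` s] -> (n <= size s)%N).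

Definition monomial_ideal (K : fieldType) (n : nat) (J : set {mpoly K[n]}) :
    Prop :=
  exists M : set 'X_{1..n}, J = ideal_gen [set 'X_[K, u] | u in M].

(* Main.v *)
Require Import Defs.
From mathcomp Require Import all_boot all_algebra.
From mathcomp Require Import classical_sets.
From mathcomp Require Import mpoly.
From mathcomp Require Import zify.

(** Write m = N + 4 and let I be generated by x^6N, x^5N y^2N, x^2N y^5N, y^6N
    and the N monomials of x^4N y^4N (x,y)^(N-1).  All products involving the
    latter are divisible by a product of two of the four former, and x^6N y^6N
    divides (x^5N y^2N)(x^2N y^5N), so I^2 is generated by the nine
    monomials with exponents N times (12,0), (11,2), (10,4), (8,5), (6,6), (5,8),
    (4,10), (2,11), (0,12).
    An antichain G of monomials is a minimum-size generating set of its ideal J: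
    no proper divisor of an element of G is in the support of an element of J,
    so the map J -> K^G extracting the coefficients at G turns multiplication
    by r into scaling by r(0), and any generating set of J spans K^G. *)

Set Implicit Arguments.
Unset Strict Implicit.
Unset Printing Implicit Defensive.

Import GRing.Theory.
Local Open Scope classical_set_scope.
Local Open Scope ring_scope.

Section IdealGen.
Variable R : comNzRingType.
Implicit Types S J : set R.

Lemma ideal_gen_is_ideal S : is_ideal (ideal_gen S).
Proof.
split=> [J [] [] //|f g Sf Sg J JS|r f Sf J JS].
- by case: (JS) => -[_ JD _] _; apply: JD; [apply: Sf|apply: Sg].
- by case: (JS) => -[_ _ JM] _; apply: JM; apply: Sf.
Qed.

Lemma sub_ideal_gen S : S `<=` ideal_gen S.
Proof. by move=> f Sf J [_ SJ]; apply: SJ. Qed.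

Lemma ideal_gen_min S J : is_ideal J -> S `<=` J -> ideal_gen S `<=` J.
Proof. by move=> Jid SJ f; apply. Qed.

End IdealGen.

Section MonomialIdeals.
Variables (K : fieldType) (n : nat).
Implicit Types (f : {mpoly K[n]}) (u v m : 'X_{1..n}) (G H : seq 'X_{1..n}).

Definition antichain G := {in G &, forall u v, (u <= v)%MM -> u = v}.

Definition dominated G f :=
  {in msupp f, forall m, has (fun u => (u <= m)%MM) G}.

Definition mon_ideal G : set {mpoly K[n]} :=
  ideal_gen [set` [seq 'X_[K, u] | u <- G]].

Lemma dominated_is_ideal G : is_ideal (dominated G).
Proof.
split=> [m|f g Gf Gg m|r f Gf m]; first by rewrite msupp0.
- by move=> /msuppD_le; rewrite mem_cat => /orP [/Gf|/Gg].
- move=> /msuppM_le /allpairsP [[m1 m2] /= [_ /Gf /hasP [u uG um2] ->]].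
  by apply/hasP; exists u => //; apply: lepm_trans um2 (lem_addl _ _).
Qed.

Lemma mon_idealP G f : mon_ideal G f <-> dominated G f.
Proof.
split.
  apply: ideal_gen_min; first exact: dominated_is_ideal.
  move=> _ /= /mapP [u uG ->] m; rewrite msuppX inE => /eqP ->.
  by apply/hasP; exists u => //; apply: lepm_refl.
have [I0 ID IM] := ideal_gen_is_ideal [set` [seq 'X_[K, u] | u <- G]].
move=> Gf; rewrite [f]mpolyE big_seq; apply: (big_ind (mon_ideal G)) => //.
move=> m /Gf /hasP [u uG um]; rewrite -(submK um) mpolyXD scalerAl.
by apply: IM; apply: sub_ideal_gen; apply: map_f.
Qed.

Lemma mon_idealX G u : u \in G -> mon_ideal G 'X_[u].
Proof. by move=> uG; apply: sub_ideal_gen; apply: map_f. Qed.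

Lemma mon_ideal_monomial G : monomial_ideal (mon_ideal G).
Proof.
exists [set` G]; congr ideal_gen.
apply/seteqP; split=> [f /mapP [u uG ->]|f [u uG <-]].
- by exists u.
- exact: map_f.
Qed.

(** The support of [f * g] lies in the sum of the two supports, so divisibility only has to be
    tested on products of generators. [H] may omit products that are multiples of others. *)
Lemma mon_ideal_mul G H :
    {in H, forall w, exists u v, [/\ u \in G, v \in G & w = (u + v)%MM]} ->
    {in G &, forall u v, has (fun w => (w <= u + v)%MM) H} ->
  ideal_mul (mon_ideal G) (mon_ideal G) = mon_ideal H.
Proof.
move=> HG GH; apply/seteqP; split; apply: ideal_gen_min.
- exact: ideal_gen_is_ideal.
- move=> _ [f /mon_idealP Gf [g /mon_idealP Gg <-]]; apply/mon_idealP => m.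
  move=> /msuppM_le /allpairsP [[m1 m2] /=].
  move=> [/Gf /hasP [u uG um] /Gg /hasP [v vG vm] ->].
  have /hasP [w wH wuv] := GH _ _ uG vG.
  apply/hasP; exists w => //; apply: lepm_trans wuv _.
  by apply/mnm_lepP => i; rewrite !mnmDE leq_add // (mnm_lepP _).
- exact: ideal_gen_is_ideal.
- move=> _ /= /mapP [_ /HG [u [v [uG vG ->]]] ->].
  rewrite mpolyXD; apply: sub_ideal_gen.
  by exists 'X_[u]; [apply: mon_idealX|exists 'X_[v] => //; apply: mon_idealX].
Qed.

Lemma mcoeffM_antichain G f r u :
  antichain G -> dominated G f -> u \in G -> (r * f)@_u = r@_0%MM * f@_u.
Proof.
(* Split off the constant term of [r]; it remains to see that [r - r(0)] contributes nothing at
   [u]. *)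
move=> Ganti Gf uG; rewrite -{1}[r](subrK (r@_0%MM)%:MP) mulrDl mcoeffD mcoeffCM.
rewrite (_ : _@_u = 0) ?add0r //; apply/eqP; rewrite mcoeff_eq0; apply/negP.
move=> /msuppM_le /allpairsP [[m1 m2] /= [m1r /Gf /hasP [v vG vm2] uE]].
have vu : (v <= u)%MM by rewrite uE; apply: lepm_trans vm2 (lem_addl _ _).
(* As [v] divides [m2], which divides [u], the antichain forces [v = m2 = u]. But [r - r(0)] has no
   constant term. *)
have m10 : m1 = 0%MM.
  apply/mnmP => i; rewrite mnm0E.
  have /mnm_lepP /(_ i) := vm2; rewrite (Ganti _ _ vG uG vu) uE mnmDE; lia.
by move: m1r; rewrite m10 mcoeff_msupp mcoeffB mcoeffC eqxx mulr1 subrr eqxx.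
Qed.

Definition coef_row G f : 'rV[K]_(size G) := \row_i f@_(nth 0%MM G i).

Lemma mon_ideal_leq_size G (s : seq {mpoly K[n]}) :
    uniq G -> antichain G ->
  mon_ideal G = ideal_gen [set` s] -> (size G <= size s)%N.
Proof.
move=> Guniq Ganti Is; pose S := \matrix_(i < size s) coef_row G s`_i.
have sub_S f : mon_ideal G f -> (coef_row G f <= S)%MS.
  rewrite {1}Is => fs.
  (* Domination is carried along because multiplication by [r] scales the row only for members of
     the ideal. *)
  suff [//] : dominated G f /\ (coef_row G f <= S)%MS.
  apply: (ideal_gen_min (J := fun f => dominated G f /\ (coef_row G f <= S)%MS)) fs.
  - have [D0 DD DM] := dominated_is_ideal G.
    split=> [|g h [Dg Sg] [Dh Sh]|r g [Dg Sg]].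
    + split=> //; rewrite (_ : coef_row G 0 = 0) ?sub0mx //.
      by apply/rowP => i; rewrite !mxE mcoeff0.
    + split; first exact: DD.
      rewrite (_ : coef_row G (g + h) = coef_row G g + coef_row G h) ?addmx_sub //.
      by apply/rowP => i; rewrite !mxE mcoeffD.
    + split; first exact: DM.
      rewrite (_ : coef_row G (r * g) = r@_0%MM *: coef_row G g) ?scalemx_sub //.
      by apply/rowP => i; rewrite !mxE (mcoeffM_antichain _ Ganti Dg) // mem_nth.
  - move=> g /= gs; split.
      by apply/mon_idealP; rewrite Is; apply: sub_ideal_gen.
    have gi : (index g s < size s)%N by rewrite index_mem.
    rewrite -[g](nth_index 0 gs).
    by rewrite -(rowK (fun i : 'I__ => coef_row G s`_i) (Ordinal gi)) row_sub.
(* The rows of the monomials in [G] form the identity matrix, so [S] has rank at least [size G]. *)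
rewrite -[leqLHS](mxrank1 K) (leq_trans _ (rank_leq_row S)) // mxrankS //.
apply/row_subP => i.
rewrite (_ : row i _ = coef_row G 'X_[nth 0%MM G i]); last first.
  by apply/rowP => j; rewrite !mxE mcoeffX nth_uniq.
by apply: sub_S; apply: mon_idealX; rewrite mem_nth.
Qed.

Lemma is_mu_mon_ideal G : uniq G -> antichain G -> is_mu (mon_ideal G) (size G).
Proof.
move=> Guniq Ganti; split; last by move=> s; apply: mon_ideal_leq_size.
by exists [seq 'X_[K, u] | u <- G]; rewrite size_map.
Qed.

End MonomialIdeals.

Definition mon2 (p : nat * nat) : 'X_{1..2} :=
  [multinom (if i == ord0 then p.1 else p.2) | i < 2].

Lemma mon2_le p q : (mon2 p <= mon2 q)%MM = (p.1 <= q.1)%N && (p.2 <= q.2)%N.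
Proof.
apply/mnm_lepP/andP => [le_pq|[le1 le2] i]; last by rewrite !mnmE; case: ifP.
by have := le_pq ord0; have := le_pq ord_max; rewrite !mnmE.
Qed.

Lemma mon2D p q : (mon2 p + mon2 q)%MM = mon2 (p.1 + q.1, p.2 + q.2)%N.
Proof. by apply/mnmP => i; rewrite mnmDE !mnmE; case: ifP. Qed.

(** Generators are listed along the staircase from the x-axis to the y-axis, so that one pairwise
    condition yields both distinctness and incomparability. *)
Definition below_right (p q : nat * nat) := (q.1 < p.1)%N && (p.2 < q.2)%N.

Lemma staircase_antichain s : pairwise below_right s ->
  uniq (map mon2 s) /\ antichain (map mon2 s).
Proof.
move=> s_stair.
have s_le p q : p \in s -> q \in s -> (mon2 p <= mon2 q)%MM -> p = q.
  move=> ps qs; rewrite mon2_le => le_pq.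
  have s_nth := pairwiseP (0%N, 0%N) s_stair.
  have [i_lt j_lt] : (index p s < size s)%N /\ (index q s < size s)%N.
    by rewrite !index_mem.
  have := s_nth _ _ i_lt j_lt; have := s_nth _ _ j_lt i_lt.
  rewrite !nth_index // /below_right.
  by case: (ltngtP (index p s)) => [_ _ /(_ isT)|_ /(_ isT)|/index_inj -> //]; lia.
split; last by move=> _ _ /mapP [p ps ->] /mapP [q qs ->] /(s_le _ _ ps qs) ->.
rewrite map_inj_in_uniq => [|p q ps qs pq].
  by apply: pairwise_uniq s_stair => p; rewrite /below_right ltnn.
by apply: s_le => //; rewrite pq lepm_refl.
Qed.

(** In the middle block [i < N], so the first exponent is [4N + (N-1-i)] without truncation. Both
    exponents there lie between [4N] and [5N-1], hence the block fits between its neighbours on the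
    staircase. *)
Definition gens (N : nat) : seq (nat * nat) :=
  [:: (6 * N, 0); (5 * N, 2 * N)]%N
  ++ [seq ((5 * N).-1 - i, 4 * N + i)%N | i <- iota 0 N]
  ++ [:: (2 * N, 5 * N); (0, 6 * N)]%N.

Definition square_gens (N : nat) : seq (nat * nat) :=
  [:: (12 * N, 0); (11 * N, 2 * N); (10 * N, 4 * N); (8 * N, 5 * N);
      (6 * N, 6 * N); (5 * N, 8 * N); (4 * N, 10 * N); (2 * N, 11 * N);
      (0, 12 * N)]%N.

Lemma gens_staircase N : (0 < N)%N -> pairwise below_right (gens N).
Proof.
move=> N0; rewrite /gens !pairwise_cat allrel_catr pairwise_map.
apply/and3P; split; last apply/and3P; last split.
- apply/andP; split; last by rewrite /allrel /below_right /=; lia.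
  apply/allrelP => p q p_in /mapP [i]; rewrite mem_iota => i_lt ->.
  by move: p_in; rewrite !inE /below_right => /orP [] /eqP -> /=; lia.
- by rewrite /= /below_right /=; lia.
- apply/allrelP => p q /mapP [i]; rewrite mem_iota => i_lt -> q_in.
  by move: q_in; rewrite !inE /below_right => /orP [] /eqP -> /=; lia.
- apply: (@sub_in_pairwise _ (fun i => i < N)%N ltn).
  + by move=> i j /= i_lt j_lt ij; rewrite /below_right /=; lia.
  + by apply/allP => i; rewrite mem_iota.
  + by rewrite -sorted_pairwise ?iota_ltn_sorted //; apply: ltn_trans.
- by rewrite /= /below_right /=; lia.
Qed.

Lemma square_gens_staircase N :
  (0 < N)%N -> pairwise below_right (square_gens N).
Proof. by move=> N0; rewrite /square_gens /below_right /=; lia. Qed.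

Lemma gensP N p : p \in gens N ->
  p \in [:: (6 * N, 0); (5 * N, 2 * N); (2 * N, 5 * N); (0, 6 * N)]%N
  \/ (4 * N <= p.1)%N && (4 * N <= p.2)%N.
Proof.
rewrite /gens !mem_cat => /or3P [|/mapP [i]|].
- by rewrite !inE => /orP [] ->; rewrite ?orbT; left.
- by rewrite mem_iota => i_lt ->; right => /=; lia.
- by rewrite !inE => /orP [] ->; rewrite ?orbT; left.
Qed.

Lemma square_gens_sum N w : w \in square_gens N ->
  exists p q, [/\ p \in gens N, q \in gens N & w = (p.1 + q.1, p.2 + q.2)%N].
Proof.
pose A := (6 * N, 0)%N; pose B := (5 * N, 2 * N)%N.
pose C := (2 * N, 5 * N)%N; pose D := (0, 6 * N)%N.
have [AG BG CG DG] : [/\ A \in gens N, B \in gens N, C \in gens N & D \in gens N].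
  by rewrite /gens !mem_cat !inE !eqxx !orbT.
(* Of the ten unordered pairs only [(B, C)] is missing: its sum [(7N, 7N)] lies above that of
   [(A, D)]. *)
have -> : square_gens N = [seq (pq.1.1 + pq.2.1, pq.1.2 + pq.2.2)%N
    | pq <- [:: (A, A); (A, B); (B, B); (A, C); (A, D); (B, D); (C, C); (C, D); (D, D)]].
  by rewrite /square_gens /=; do 9?[congr cons; first by congr pair; lia].
have /allP pairsG : all (fun pq => (pq.1 \in gens N) && (pq.2 \in gens N))
    [:: (A, A); (A, B); (B, B); (A, C); (A, D); (B, D); (C, C); (C, D); (D, D)].
  by rewrite /= AG BG CG DG.
by move=> /mapP [[p q] /pairsG /andP [pG qG] ->]; exists p, q.
Qed.

(** In units of [N], an inner generator is at least (4,4). Adding the outer ones in order gives at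
    least (10,4), (9,6), (6,9), (4,10), which lie above (10,4), (8,5), (5,8), (4,10); two inner ones
    give at least (8,8), above (6,6). *)
Lemma gens_sum N p q : p \in gens N -> q \in gens N ->
  has (fun w => (w.1 <= p.1 + q.1)%N && (w.2 <= p.2 + q.2)%N) (square_gens N).
Proof.
case: p q => a b [c d] /gensP p_in /gensP q_in.
case: p_in; case: q_in; rewrite ?inE.
- by move=> /or4P [] /eqP [-> ->] /or4P [] /eqP [-> ->] /=; lia.
- by move=> /= hq /or4P [] /eqP [-> ->]; lia.
- by move=> /or4P [] /eqP [-> ->] /= hp; lia.
- by move=> /= hp hq; lia.
Qed.

Theorem theorem1p1 (K : fieldType) (m : nat) (hm : (5 <= m)%N) :
  exists I : set {mpoly K[2]},
    [/\ monomial_ideal I, is_mu I m & is_mu (ideal_mul I I) 9].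
Proof.
pose N := (m - 4)%N; have N0 : (0 < N)%N by rewrite subn_gt0.
exists (mon_ideal (map mon2 (gens N))); split; first exact: mon_ideal_monomial.
  have [Guniq Ganti] := staircase_antichain (gens_staircase N0).
  have := is_mu_mon_ideal K Guniq Ganti.
  rewrite size_map /gens !size_cat size_map size_iota /=.
  by rewrite (_ : (2 + (N + 2))%N = m) // /N; lia.
have [Huniq Hanti] := staircase_antichain (square_gens_staircase N0).
rewrite (@mon_ideal_mul _ _ _ (map mon2 (square_gens N))).
- exact: is_mu_mon_ideal.
- move=> _ /mapP [w /square_gens_sum [p [q [pG qG ->]]] ->].
  by exists (mon2 p), (mon2 q); rewrite mon2D !map_f.
- move=> _ _ /mapP [p pG ->] /mapP [q qG ->]; rewrite mon2D has_map.
  by apply: sub_has (gens_sum pG qG) => w; rewrite /= mon2_le.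
Qed.
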